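(* Let $G$ be a finite simple graph on the vertex set $V=\{x_1,\ldots,x_n\}$, let $R=\mathbf{k}[x_1,\ldots,x_n]$, and define $V_1(G)=\{x\in V:\deg_G(x)=1\}$, $V_2(G)=\{x\in V:\deg_G(x)\ge 2,\ N_G(x)\cap V_1(G)\ne\emptyset\}$, $V_3(G)=\{x\in V:\deg_G(x)\ge 2,\ N_G(x)\cap V_1(G)=\emptyset\}$ and $V_1'(G)=\{x\in V_1(G): N_G(x)\subseteq V_1(G)\}$. Assume that $V_3(G)$ is an independent set of $G$. Then (i) $a_G=|V_2(G)|+\tfrac12|V_1'(G)|$; (ii) $\operatorname{reg}(R/NI(G))=a_G$; (iii) $\operatorname{pd}(R/NI(G))=\operatorname{bight}(NI(G))=n-a_G$.
   Context: $\mathbf{k}$ is a field, vertices are identified with variables, $R$ is standard graded. $N_G(x)$ is the set of neighbors of $x$ and $N[x]=\{x\}\cup N_G(x)$. The closed neighborhood ideal is $NI(G)=\langle \prod_{x_j\in N[x_i]}x_j : x_i\in V\rangle$. $a_G$ is the matching number (maximum number of pairwise disjoint edges). An independent set is a set of vertices containing no edge. $\operatorname{bight}(I)$ is the maximum height of a minimal prime of $I$. *)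

(* Defs.v *)
From HB Require Import structures.
From mathcomp Require Import all_boot all_order all_algebra.
From mathcomp Require Import mpoly.
Set Implicit Arguments. Unset Strict Implicit. Unset Printing Implicit Defensive.
Import Order.TTheory GRing.Theory.
Local Open Scope ring_scope.

Definition simple_graph (n : nat) (e : rel 'I_n) : Prop :=
  ssrbool.symmetric e /\ ssrbool.irreflexive e.

Definition nbhd n (e : rel 'I_n) (x : 'I_n) : {set 'I_n} := [set y | e x y].
Definition closed_nbhd n (e : rel 'I_n) (x : 'I_n) : {set 'I_n} := x |: nbhd e x.
Definition deg n (e : rel 'I_n) (x : 'I_n) : nat := #|nbhd e x|.

Definition V1 n (e : rel 'I_n) : {set 'I_n} := [set x | deg e x == 1%N].
Definition V2 n (e : rel 'I_n) : {set 'I_n} :=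
  [set x | (2 <= deg e x)%N && (nbhd e x :&: V1 e != set0)].
Definition V3 n (e : rel 'I_n) : {set 'I_n} :=
  [set x | (2 <= deg e x)%N && (nbhd e x :&: V1 e == set0)].
Definition V1' n (e : rel 'I_n) : {set 'I_n} :=
  [set x in V1 e | nbhd e x \subset V1 e].

Definition independent n (e : rel 'I_n) (S : {set 'I_n}) : bool :=
  [forall x in S, forall y in S, ~~ e x y].

Definition is_edge n (e : rel 'I_n) (f : {set 'I_n}) : bool :=
  [exists x, exists y, e x y && (f == [set x; y])].
Definition matchingb n (e : rel 'I_n) (M : {set {set 'I_n}}) : bool :=
  [forall f in M, is_edge e f] &&
  [forall f in M, forall g in M, (f != g) ==> [disjoint f & g]].
Definition matching_number n (e : rel 'I_n) : nat :=
  \max_(M : {set {set 'I_n}} | matchingb e M) #|M|.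

Section Ideals.
Variables (k : fieldType) (n : nat).
Local Notation R := {mpoly k[n]}.

Definition NI_gen (e : rel 'I_n) (i : 'I_n) : R :=
  \prod_(j in closed_nbhd e i) 'X_j.

Definition gen_ideal (m : nat) (g : 'I_m -> R) (p : R) : Prop :=
  exists c : 'I_m -> R, p = \sum_(j < m) c j * g j.

Definition NI (e : rel 'I_n) : R -> Prop := gen_ideal (NI_gen e).

Definition is_ideal (I : R -> Prop) : Prop :=
  I 0 /\ (forall x y, I x -> I y -> I (x + y)) /\ (forall r x, I x -> I (r * x)).
Definition is_prime (P : R -> Prop) : Prop :=
  is_ideal P /\ ~ P 1 /\ (forall x y, P (x * y) -> P x \/ P y).
Definition subI (I J : R -> Prop) : Prop := forall x, I x -> J x.

Definition minimal_prime (I P : R -> Prop) : Prop :=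
  is_prime P /\ subI I P /\
  (forall Q, is_prime Q -> subI I Q -> subI Q P -> subI P Q).

Definition prime_chain (h : nat) (C : nat -> R -> Prop) (P : R -> Prop) : Prop :=
  (forall i, (i <= h)%N -> is_prime (C i)) /\
  (forall i, (i < h)%N -> subI (C i) (C i.+1) /\ ~ subI (C i.+1) (C i)) /\
  (forall x, C h x <-> P x).

Definition height_eq (P : R -> Prop) (h : nat) : Prop :=
  (exists C, prime_chain h C P) /\ (forall h' C, prime_chain h' C P -> (h' <= h)%N).

Definition bight_eq (I : R -> Prop) (b : nat) : Prop :=
  (exists P, minimal_prime I P /\ height_eq P b) /\
  (forall P h, minimal_prime I P -> height_eq P h -> (h <= b)%N).

(* F_i = (+)_{l < rk i} R(-sh i l); the differential F_{i+1} -> F_i is the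
   matrix d i acting on row vectors (v |-> v *m d i); F_0 = R with shift 0. *)
Record graded_free_complex := GFC {
  len : nat;
  rk : nat -> nat;
  sh : forall i, 'I_(rk i) -> nat;
  dm : forall i, 'M[R]_(rk i.+1, rk i)
}.

Definition graded_free_resolution (I : R -> Prop) (F : graded_free_complex) : Prop :=
  rk F 0 = 1%N /\
      (forall i, (len F < i)%N -> rk F i = 0%N) /\
      (0 < rk F (len F))%N /\
      (forall (l : 'I_(rk F 0)), sh l = 0%N) /\
      (* homogeneity: d i is a degree-0 map of graded free modules *)
      (forall i (l : 'I_(rk F i.+1)) (m : 'I_(rk F i)),
          dm F i l m = 0 \/
          ((sh m <= sh l)%N /\ dm F i l m \is (sh l - sh m)%N.-homog)) /\
      (* exactness at F_{i+1} for all i (this includes injectivity of the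
         last map, as F_{len+1} = 0) *)
      (forall i (v : 'rV[R]_(rk F i.+1)),
          v *m dm F i = 0 <-> exists w : 'rV[R]_(rk F i.+2), v = w *m dm F i.+1) /\
      (forall p : R, I p <-> exists w : 'rV[R]_(rk F 1),
                                forall j : 'I_(rk F 0), (w *m dm F 0) 0 j = p).

(* minimality: all entries of the differentials lie in the homogeneous
   maximal ideal (x_1, ..., x_n), i.e. have zero constant term *)
Definition minimal_res (F : graded_free_complex) : Prop :=
  forall i l m, (dm F i l m)@_0%MM = 0.

(* projective dimension and regularity read off a minimal graded free
   resolution: pd = its length, reg = max { j - i : beta_{i,j} <> 0 } *)
Definition res_pd (F : graded_free_complex) : nat := len F.
Definition res_reg (F : graded_free_complex) : nat :=
  \max_(i < (len F).+1) \max_(l < rk F i) (sh l - i)%N.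

End Ideals.

(* Main.v *)
(* Let [C] consist of the vertices in [V2] and of one endpoint of every
   component that is a single edge.  Every neighbour of a vertex [w] outside [C]
   lies in [C], and every vertex of [C] is the only neighbour of some vertex
   outside [C].  Hence [C] is a vertex cover matched into its complement, so
   [a_G = |C|]; moreover [NI(G)] is generated by the monomials of the closed
   neighbourhoods of the [w] outside [C], each of which contains the private
   variable [x_w].  Private variables make the Taylor resolution on these
   [n - |C|] generators minimal.  Its length is [n - |C|], and its shift at a set
   [S] of generators is the size of the union of their closed neighbourhoods, at
   most [|S| + |C|] with equality when [S] is everything.  The big height is
   attained at the prime generated by the private variables, and cannot exceed
   the number of generators because a minimal prime is generated by a minimal
   set of variables meeting every generator. *)
Require Import Defs.
From HB Require Import structures.
From mathcomp Require Import all_boot all_order all_algebra.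
From mathcomp Require Import mpoly zify ring.
From Stdlib Require Import Classical.
Set Implicit Arguments. Unset Strict Implicit. Unset Printing Implicit Defensive.
Import GRing.Theory.
Local Open Scope ring_scope.

(** * Chains of primes in a polynomial ring have length at most [n] *)

Section Primes.
Variables (k : fieldType) (n : nat).
Local Notation R := {mpoly k[n]}.
Implicit Types (P Q I : R -> Prop) (S T : {set 'I_n}).

Lemma idealB P x y : is_ideal P -> P x -> P y -> P (x - y).
Proof.
by case=> _ [addP mulP] Px Py; apply: addP => //; rewrite -mulN1r; apply: mulP.
Qed.

Lemma ideal_sum P (J : Type) (r : seq J) (A : pred J) (F : J -> R) :
  is_ideal P -> (forall j, A j -> P (F j)) -> P (\sum_(j <- r | A j) F j).
Proof. by case=> P0 [addP _] PF; elim/big_rec: _ => // j x Aj; apply/addP/PF. Qed.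

Lemma primeX P y j x : is_prime P -> ~ P y -> P (y ^+ j * x) -> P x.
Proof.
move=> [_ [_ primeP]] nPy; elim: j x => [|j IH] x; first by rewrite mul1r.
by rewrite exprSr -mulrA => /IH /primeP[].
Qed.

(** Since [y] lies in [P'], the sum is congruent to [q 0] modulo [P'], which forces [q 0 = 0]. What
    remains is [y] times a shorter sum, and [y] cancels because it is outside the prime [P]. *)
Lemma prime_coef_eq0 P P' y N (q : nat -> R) :
    is_prime P -> is_ideal P' -> subI P P' -> ~ P y -> P' y ->
    (forall j, (j < N)%N -> P' (q j) -> q j = 0) ->
    P (\sum_(j < N) y ^+ j * q j) ->
  forall j, (j < N)%N -> q j = 0.
Proof.
move=> prP idP' PP' nPy P'y; elim: N q => // N IH q q0 Pq.
have Eq : \sum_(j < N.+1) y ^+ j * q j =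
          q 0%N + y * \sum_(j < N) y ^+ j * q j.+1.
  rewrite big_ord_recl mul1r; congr (_ + _); rewrite mulr_sumr.
  by apply: eq_bigr => i _; rewrite mulrA -exprS.
have q00 : q 0%N = 0.
  apply: q0 => //; rewrite -[q _](addrK (y * \sum_(j < N) y ^+ j * q j.+1)) -Eq.
  apply: idealB (PP' _ Pq) _ => //; rewrite mulrC.
  by case: idP' => _ [_]; apply.
case=> [|j] // ltjN; apply: (IH (fun j => q j.+1)) => // [i|]; first exact: (q0 i.+1).
by apply: (@primeX _ y 1) => //; move: Pq; rewrite Eq q00 add0r.
Qed.

(* The exponents of the [a]-th monomial in [g 0, ..., g h.-1] are the [h]
   base-[N] digits of [a], most significant first. *)
Fixpoint digit_monomial N h (g : nat -> R) a : R :=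
  if h is h'.+1 then
    g 0%N ^+ (a %/ N ^ h')%N *
      digit_monomial N h' (fun i => g i.+1) (a %% N ^ h')%N
  else 1.

Lemma digit_monomial_sumS N h g (c : nat -> k) :
  \sum_(a < N ^ h.+1) c a *: digit_monomial N h.+1 g a =
  \sum_(j < N) g 0%N ^+ j *
    \sum_(a < N ^ h) c (j * N ^ h + a)%N *: digit_monomial N h (fun i => g i.+1) a.
Proof.
rewrite -(big_mkord xpredT (fun a => c a *: digit_monomial N h.+1 g a)) expnS.
rewrite big_nat_mul big_mkord; apply: eq_bigr => j _.
rewrite -{1}[(j * _)%N]add0n mulSn big_addn addnK big_mkord mulr_sumr.
apply: eq_bigr => a _ /=; have ltaN := ltn_ord a.
rewrite [(a + _)%N]addnC divnMDl ?(leq_ltn_trans _ ltaN) // divn_small //.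
by rewrite addn0 modnMDl modn_small // scalerAr.
Qed.

(* Elements [g i] of [C i.+1] outside [C i] are algebraically independent modulo
   [C 0]: cancelling powers of [g 0] leaves a relation modulo [C 1] among the
   others. *)
Lemma prime_chain_indep N h (C : nat -> R -> Prop) (g : nat -> R) (c : nat -> k) :
    (forall i, (i <= h)%N -> is_prime (C i)) ->
    (forall i, (i < h)%N -> subI (C i) (C i.+1)) ->
    (forall i, (i < h)%N -> C i.+1 (g i) /\ ~ C i (g i)) ->
    C 0%N (\sum_(a < N ^ h) c a *: digit_monomial N h g a) ->
  forall a, (a < N ^ h)%N -> c a = 0.
Proof.
elim: h C g c => [|h IH] C g c primeC subC gC.
  rewrite big_ord1 => Cc [|a] // _; apply/eqP/negPn/negP => c0.
  have [[_ [_ mulC]] [n1 _]] := primeC 0%N isT; case: n1.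
  by have /= := mulC (c 0%N)^-1%:MP _ Cc; rewrite mul_mpolyC scalerA mulVf // scale1r.
rewrite digit_monomial_sumS => Cq a lta.
pose q (j : nat) : R := \sum_(a < N ^ h)
  c (j * N ^ h + a)%N *: digit_monomial N h (fun i => g i.+1) a.
have cq j : C 1%N (q j) -> forall b, (b < N ^ h)%N -> c (j * N ^ h + b)%N = 0.
  move=> C1q; apply: (IH (fun i => C i.+1) (fun i => g i.+1)
                         (fun b => c (j * N ^ h + b)%N)) => // i;
    [exact: (primeC i.+1)|exact: (subC i.+1)|exact: (gC i.+1)].
have q0 j : C 1%N (q j) -> q j = 0.
  by move/cq => c0; apply: big1 => b _; rewrite c0 ?scale0r.
have [C1g C0g] := gC 0%N isT.
have ideal1 : is_ideal (C 1%N) by case: (primeC 1%N isT).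
have Nh : (0 < N ^ h)%N by move: lta; rewrite expnS; case: (N ^ h)%N => //; rewrite muln0.
have ltj : (a %/ N ^ h < N)%N by rewrite ltn_divLR // -expnS.
rewrite (divn_eq a (N ^ h)); apply: cq; last by rewrite ltn_mod.
have -> : q (a %/ N ^ h)%N = 0; last by case: ideal1.
apply: (prime_coef_eq0 (primeC 0%N isT) ideal1 (subC 0%N isT) C0g C1g _ Cq ltj).
by move=> j _; exact: q0.
Qed.

Lemma msize_digit_monomial N h g D a :
    (forall i, (i < h)%N -> (msize (g i) <= D.+1)%N) -> (a < N ^ h)%N ->
  (msize (digit_monomial N h g a) <= (h * (N * D)).+1)%N.
Proof.
have msM (p q : R) d f : (msize p <= d.+1)%N -> (msize q <= f.+1)%N ->
    (msize (p * q) <= (d + f).+1)%N.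
  case: (eqVneq p 0) => [->|p0]; first by rewrite mul0r msize0.
  case: (eqVneq q 0) => [->|q0]; first by rewrite mulr0 msize0.
  by rewrite msizeM //; move: (msize p) (msize q) => u v; lia.
elim: h g a => [|h IH] g a leD; first by rewrite /= msize1.
move=> lta /=; rewrite mulSn; have Nh : (0 < N ^ h)%N.
  by move: lta; rewrite expnS; case: (N ^ h)%N => //; rewrite muln0.
apply: (msM); last by apply: IH; [move=> i; exact: (leD i.+1)|rewrite ltn_mod].
have: (a %/ N ^ h <= N)%N by rewrite ltnW // ltn_divLR // -expnS.
move: (a %/ _)%N => j lejN; apply: leq_trans (_ : (j * D).+1 <= _)%N; last first.
  by rewrite ltnS leq_mul2r lejN orbT.
elim: j {lejN} => [|j IHj]; first by rewrite msize1.
by rewrite exprS mulSn; apply: msM => //; apply: leD.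
Qed.

Lemma card_bmultinom b : (#|{: 'X_{1..n < b}}| <= b ^ n)%N.
Proof.
have lt_b (m : 'X_{1..n < b}) i : (bmnm m i < b)%N.
  by apply: leq_ltn_trans (bmdeg m); rewrite mdegE (bigD1 i) //= leq_addr.
pose f (m : 'X_{1..n < b}) : {ffun 'I_n -> 'I_b} := [ffun i => Ordinal (lt_b m i)].
have injf : injective f.
  move=> m1 m2 /ffunP eqf; apply/val_inj/mnmP => i.
  by have := eqf i; rewrite !ffunE => /(congr1 val).
by have := leq_card f injf; rewrite card_ffun !card_ord.
Qed.

(* There are more monomials in [n.+1] polynomials, with exponents below [N], than
   monomials in the [n] variables of the degrees they reach, once [N] is large. *)
Lemma poly_relation (g : nat -> R) :
  exists N (c : nat -> k), \sum_(a < N ^ n.+1) c a *: digit_monomial N n.+1 g a = 0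
    /\ exists2 a, (a < N ^ n.+1)%N & c a != 0.
Proof.
pose D := (\max_(i < n.+1) msize (g i))%N.
have leD i : (i < n.+1)%N -> (msize (g i) <= D.+1)%N.
  move=> lti; apply: leqW.
  exact: (leq_bigmax_cond (F := fun i : 'I_n.+1 => msize (g i)) (Ordinal lti)).
(* All digit monomials have degree below [b]. At most [b ^ n = N ^ n * E ^ n] monomials in the
   variables do, fewer than [N ^ n.+1] since [N > E ^ n]; so [M] has a left kernel. *)
pose E := (n.+1 * D).+1; pose N := (E ^ n).+1; pose b := (N * E)%N.
pose f := digit_monomial N n.+1 g.
pose M : 'M[k]_(N ^ n.+1, #|{: 'X_{1..n < b}}|) :=
  \matrix_(a, j) (f a)@_(bmnm (enum_val j : 'X_{1..n < b})).
have: kermx M != 0.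
  rewrite kermx_eq0 /row_free; apply/eqP => rkM.
  have := leq_trans (rank_leq_col M) (card_bmultinom b).
  by rewrite rkM /b expnMn expnSr leq_pmul2l ?expn_gt0 // ltnn.
case/rowV0Pn => v /sub_kermxP vM /rV0Pn[a0 va0].
exists N, (fun a => if insub a is Some i then v 0 i else 0); split; last first.
  by exists a0 => //; rewrite valK.
apply/mpolyP => m; rewrite raddf_sum mcoeff0 /=.
under eq_bigr => a _ do rewrite valK mcoeffZ.
have [ltmb|gtmb] := ltnP (mdeg m) b; last first.
  apply: big1 => a _; rewrite (memN_msupp_eq0 (msize_mdeg_ge _)) ?mulr0 //.
  apply: leq_trans (msize_digit_monomial leD (ltn_ord a)) _.
  by apply: leq_trans gtmb; rewrite /b /E mulnCA; rewrite /N; lia.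
have /matrixP/(_ 0 (enum_rank (BMultinom ltmb))) := vM; rewrite !mxE; apply: etrans.
by apply: eq_bigr => a _; rewrite !mxE enum_rankK.
Qed.

(** Elements taken from the successive differences of [n.+1] strict inclusions would be
    algebraically independent modulo [C 0], yet any [n.+1] polynomials satisfy a relation. *)
Lemma prime_chain_le h (C : nat -> R -> Prop) :
    (forall i, (i <= h)%N -> is_prime (C i)) ->
    (forall i, (i < h)%N -> subI (C i) (C i.+1) /\ ~ subI (C i.+1) (C i)) ->
  (h <= n)%N.
Proof.
move=> primeC subC; rewrite leqNgt; apply/negP => lt_nh.
have [g gC]: exists g, forall i, (i < h)%N -> C i.+1 (g i) /\ ~ C i (g i).
  elim: h {primeC lt_nh} subC => [|h IH] subC; first by exists (fun=> 0).
  have [i ltih|g gC] := IH; first exact/subC/leqW.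
  have [_ /not_all_ex_not[x nCx]] := subC h (leqnn _).
  have Cx := imply_to_and _ _ nCx.
  exists (fun i => if i == h then x else g i) => i; rewrite ltnS leq_eqVlt.
  by case: eqP => [->|_] //= lti; apply: gC.
have [N [c [c_eq0 [a lta /eqP]]]] := poly_relation g; case.
apply: (@prime_chain_indep N n.+1 C g c) => // [i lei|i lti|i lti|].
- exact/primeC/(leq_trans lei).
- by have [] := subC i (leq_trans lti lt_nh).
- exact/gC/(leq_trans lti).
- by rewrite c_eq0; have [[]] := primeC 0%N isT.
Qed.

(** * Primes generated by variables, and big height *)

Definition kill_vars S : R -> R :=
  comp_mpoly [tuple if i \in S then 0 else 'X_i | i < n].
HB.instance Definition _ S := GRing.LRMorphism.copy (kill_vars S) (kill_vars S).

(** The ideal generated by the variables in [S], encoded as a kernel: it is prime because the target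
    is a domain. *)
Definition var_prime S (p : R) : Prop := kill_vars S p = 0.

Lemma kill_varsX S i : kill_vars S 'X_i = if i \in S then 0 else 'X_i.
Proof. by rewrite /kill_vars comp_mpolyXU -tnth_nth tnth_mktuple. Qed.

Lemma var_primeX S i : var_prime S 'X_i <-> i \in S.
Proof.
rewrite /var_prime kill_varsX; case: ifP => //; split=> // /mpolyP/(_ U_(i)%MM)/eqP.
by rewrite mcoeffXU eqxx mcoeff0 oner_eq0.
Qed.

Lemma var_prime_prime S : is_prime (var_prime S).
Proof.
rewrite /var_prime; split; [split; [|split=> [x y x0 y0|r x x0]]|split=> [|x y]].
- exact: rmorph0.
- by rewrite rmorphD /= x0 y0 addr0.
- by rewrite rmorphM /= x0 mulr0.
- by rewrite rmorph1 => /eqP; rewrite oner_eq0.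
- by rewrite rmorphM => /eqP; rewrite mulf_eq0 => /orP[]/eqP; [left|right].
Qed.

Lemma var_primeXm S (m : 'X_{1..n}) :
  var_prime S 'X_[m] <-> [exists i in S, m i != 0%N].
Proof.
rewrite /var_prime mpolyXE_id rmorph_prod /=; split=> [/eqP|/exists_inP[i Si mi]].
  rewrite prodf_seq_eq0 => /hasP[i _]; rewrite rmorphXn /= expf_eq0 lt0n /=.
  by case/andP=> mi /eqP/var_primeX Si; apply/exists_inP; exists i.
by rewrite (bigD1 i) //= rmorphXn /= kill_varsX Si expr0n (negPf mi) mul0r.
Qed.

Lemma kill_varsXm S (m : 'X_{1..n}) :
  kill_vars S 'X_[m] = if [exists i in S, m i != 0%N] then 0 else 'X_[m].
Proof.
case: ifPn => [/var_primeXm //|/exists_inPn Sm].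
rewrite mpolyXE_id rmorph_prod /=; apply: eq_bigr => i _.
rewrite rmorphXn /= kill_varsX; case: ifP => // /Sm/negPn/eqP->.
by rewrite !expr0.
Qed.

(** Substituting zero for the variables of [S] removes exactly the monomials divisible by one of
    them, and those all lie in [P]. *)
Lemma sub_var_prime P S :
  is_ideal P -> (forall i, i \in S -> P 'X_i) -> subI (var_prime S) P.
Proof.
move=> idP PX p p0; rewrite -[p]subr0 -p0 {p0}.
have [P0 [addP mulP]] := idP.
elim/mpolyind: p => [|c m p _ _ IH]; first by rewrite rmorph0 subr0.
rewrite rmorphD /= opprD addrACA; apply: addP IH => {p}.
rewrite linearZ /= -scalerBr -mul_mpolyC; apply: (mulP).
rewrite kill_varsXm; case: ifP => [/exists_inP[i Si mi]|_]; last by rewrite subrr.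
rewrite subr0 -(@submK _ U_(i)%MM m) ?lep1mP // mpolyXD.
exact/mulP/PX.
Qed.

Lemma prime_Xm P (m : 'X_{1..n}) :
  is_prime P -> P 'X_[m] -> exists2 i, m i != 0%N & P 'X_i.
Proof.
move=> primeP; have [_ [P1 mulP]] := primeP; rewrite mpolyXE_id.
elim/big_ind: _ => // [x y IHx IHy /mulP[/IHx|/IHy] //|i _ Pi].
exists i; first by apply/eqP => mi; apply: P1; rewrite mi expr0 in Pi.
elim: (m i) Pi => [|j IHj]; first by rewrite expr0.
by rewrite exprS => /mulP[|/IHj].
Qed.

Lemma var_primeS S T : subI (var_prime S) (var_prime T) <-> S \subset T.
Proof.
split=> [subST|/subsetP subST].
  by apply/subsetP => i Si; apply/var_primeX/subST/var_primeX.
apply: sub_var_prime => [|i /subST Ti]; last exact/var_primeX.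
by have [] := var_prime_prime T.
Qed.

(* A chain below [var_prime S] is prolonged by the variable primes above it, and
   the resulting chain has at most [n] steps. *)
Lemma height_var_prime S : height_eq (var_prime S) #|S|.
Proof.
pose s := enum S ++ enum (~: S); pose V i := [set x in take i s].
have size_s : size s = n by rewrite size_cat -!cardE cardsC card_ord.
have uniq_s : uniq s.
  rewrite cat_uniq !enum_uniq andbT /=; apply/hasPn => i.
  by rewrite !mem_enum inE.
have cardV i : (i <= n)%N -> #|V i| = i.
  move=> lein; rewrite cardsE (card_uniqP _) ?take_uniq // size_take size_s.
  by case: ltnP => // leni; apply/eqP; rewrite eqn_leq lein leni.
have VS i j : (i <= j)%N -> V i \subset V j.
  move=> leij; apply/subsetP => x; rewrite !inE -[take i s](take_takel _ leij).
  exact: mem_take.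
have ltV i : (i < n)%N -> ~ subI (var_prime (V i.+1)) (var_prime (V i)).
  move=> ltin /var_primeS/subset_leq_card; rewrite !cardV //; last exact: ltnW.
  by rewrite ltnn.
have VE : V #|S| = S.
  apply/setP => x; rewrite inE take_size_cat -?cardE //; exact: mem_enum.
have leS : (#|S| <= n)%N by have := max_card S; rewrite card_ord.
split.
  exists (fun i => var_prime (V i)); split=> [i _|]; first exact: var_prime_prime.
  split=> [i lti|x]; last by rewrite VE.
  by split; [exact/var_primeS/VS|exact/ltV/(leq_trans lti)].
move=> h C [primeC [subC CE]]; rewrite -(leq_add2r (n - #|S|)) subnKC //.
pose D i := if (i <= h)%N then C i else var_prime (V (#|S| + (i - h))%N).
apply: (@prime_chain_le _ D) => i; rewrite /D; first by case: ifP => // *;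
  [exact: primeC|exact: var_prime_prime].
case: (ltngtP i h) => [ltih|ltih|->] lti; first exact: subC.
  rewrite subSn ?(ltnW ltih) // addnS; split; first exact/var_primeS/VS.
  by apply: ltV; lia.
rewrite subSnn addn1; split=> [x /CE|sub].
  by have /var_primeS := VS _ _ (leqnSn #|S|); rewrite VE; apply.
by apply: (@ltV #|S|); [lia|move=> x /sub/CE; rewrite VE].
Qed.

(* A minimal cover contains at most one variable per generator. *)
Lemma minimal_prime_height I (W : {set 'I_n}) (A : 'I_n -> {set 'I_n}) P h :
    (forall Q, is_prime Q -> subI I Q <-> forall w, w \in W -> Q 'X_[mesym1 (A w)]) ->
    minimal_prime I P -> height_eq P h -> (h <= #|W|)%N.
Proof.
move=> IE [primeP [subIP minP]] heightP.
have XA w : w \in W -> exists2 i, i \in A w & P 'X_i.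
  move=> Ww; have [i mi Pi] := prime_Xm primeP ((IE _ primeP).1 subIP w Ww).
  by exists i => //; move: mi; rewrite mnmE; case: (i \in A w).
have [c cA]: exists c : 'I_n -> 'I_n, forall w, w \in W -> c w \in A w /\ P 'X_(c w).
  suff [c cA]: exists c : {ffun 'I_n -> 'I_n},
      forall w, w \in enum W -> c w \in A w /\ P 'X_(c w).
    by exists c => w Ww; apply: cA; rewrite mem_enum.
  have: {subset enum W <= W} by move=> w; rewrite mem_enum.
  elim: (enum W) => [|w s IH] sW; first by exists [ffun i => i].
  have [w' sw'|c cA] := IH; first by apply: sW; rewrite inE sw' orbT.
  have [i Ai Pi] := XA w (sW _ (mem_head _ _)).
  exists [ffun x => if x == w then i else c x] => x; rewrite inE ffunE.
  by case: eqP => [->|_] //= /cA.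
(* The chosen variables generate a prime that contains [I] and is contained in [P], so minimality
   identifies it with [P]. *)
pose S := c @: W.
have primeS := var_prime_prime S.
have subSP : subI (var_prime S) P.
  by apply: sub_var_prime => [|i /imsetP[w Ww ->]]; [case: primeP|have [] := cA w Ww].
have subPS : subI P (var_prime S).
  apply: minP => //; apply/IE => // w Ww; apply/var_primeXm/exists_inP.
  by exists (c w); [exact: imset_f|rewrite mnmE; have [-> _] := cA w Ww].
apply: leq_trans (leq_imset_card c W).
have [[C [primeC [subC CE]]] _] := heightP.
have [_ leS] := height_var_prime S; apply: (leS h C); split=> //; split=> // x.
by split=> [/CE/subPS //|/subSP/CE].
Qed.

(** A prime over [I] inside [var_prime W] contains a variable of each [A w]; that variable belongs
    to [W], hence is the private [w]. So [var_prime W] is a minimal prime. *)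
Lemma bight_private I (W : {set 'I_n}) (A : 'I_n -> {set 'I_n}) :
    (forall Q, is_prime Q -> subI I Q <-> forall w, w \in W -> Q 'X_[mesym1 (A w)]) ->
    (forall w w', w \in W -> w' \in W -> (w \in A w') = (w == w')) ->
  bight_eq I #|W|.
Proof.
move=> IE AE; split; last by move=> P h; apply: minimal_prime_height IE.
have primeW := var_prime_prime W.
exists (var_prime W); split; last exact: height_var_prime.
split=> //; split.
  apply/IE => // w Ww; apply/var_primeXm/exists_inP; exists w => //.
  by rewrite mnmE AE // eqxx.
move=> Q primeQ subIQ subQW; apply: sub_var_prime => [|w Ww]; first by case: primeQ.
have [i mi Qi] := prime_Xm primeQ ((IE _ primeQ).1 subIQ w Ww).
have Wi : i \in W by apply/var_primeX/subQW.
suff -> : w = i by [].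
by apply/eqP; rewrite eq_sym -AE //; move: mi; rewrite mnmE; case: (i \in A w).
Qed.

End Primes.

(** * Comparison of graded free resolutions *)

Section Comparison.
Variables (k : fieldType) (n : nat).
Local Notation R := {mpoly k[n]}.

Definition homog_mx a b (sa : 'I_a -> nat) (sb : 'I_b -> nat) (M : 'M[R]_(a, b)) :=
  forall l m, M l m = 0 \/ (sb m <= sa l)%N /\ M l m \is (sa l - sb m)%N.-homog.

Lemma pihomogM d e (p q : R) : q \is e.-homog ->
  pihomog mdeg d (p * q) = if (e <= d)%N then pihomog mdeg (d - e) p * q else 0.
Proof.
move=> hq; elim/mpolyind: p => [|c m p _ _ IH].
  by rewrite mul0r !raddf0 mul0r if_same.
rewrite mulrDl !raddfD /= IH -scalerAl !linearZ /= pihomogX.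
have hXq : 'X_[m] * q \is (mdeg m + e).-homog.
  by apply: dhomogM => //; rewrite dhomogX.
have [<-|ne] := eqVneq (mdeg m + e)%N d.
  by rewrite (pihomog_dE hXq) leq_addl addnK eqxx mulrDl scalerAl.
rewrite (pihomog_ne0 ne hXq) scaler0 add0r; case: leqP => // led.
by rewrite ifN ?scaler0 ?add0r //; apply: contra ne => /eqP->; rewrite subnK.
Qed.

Lemma homog_mx_mul a b c (sa : 'I_a -> nat) (sb : 'I_b -> nat) (sc : 'I_c -> nat)
    (M : 'M[R]_(a, b)) (N : 'M[R]_(b, c)) :
  homog_mx sa sb M -> homog_mx sb sc N -> homog_mx sa sc (M *m N).
Proof.
move=> hM hN l j; rewrite mxE.
have MN m : M l m * N m j = 0 \/
    (sc j <= sa l)%N /\ M l m * N m j \is (sa l - sc j)%N.-homog.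
  have [->|[le1 h1]] := hM l m; first by rewrite mul0r; left.
  have [->|[le2 h2]] := hN m j; first by rewrite mulr0; left.
  right; split; first exact: leq_trans le2 le1.
  have -> : (sa l - sc j = (sa l - sb m) + (sb m - sc j))%N by lia.
  exact: dhomogM.
have [le|gt] := leqP (sc j) (sa l); [right; split=> //|left].
  by apply: rpred_sum => m _; have [->|[]] := MN m; rewrite ?rpred0.
by apply: big1 => m _; have [|[]] := MN m; rewrite // leqNgt gt.
Qed.

(** Replacing every entry of a lift by its component of the degree prescribed by the shifts keeps
    the product, because [M] and [D] are already homogeneous. *)
Lemma homog_mx_lift a b c (sa : 'I_a -> nat) (sb : 'I_b -> nat) (sc : 'I_c -> nat)
    (M : 'M[R]_(a, c)) (D : 'M[R]_(b, c)) (X : 'M[R]_(a, b)) :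
    homog_mx sa sc M -> homog_mx sb sc D -> M = X *m D ->
  exists2 Y : 'M[R]_(a, b), homog_mx sa sb Y & M = Y *m D.
Proof.
move=> hM hD MXD.
exists (\matrix_(l, m) if (sb m <= sa l)%N
                       then pihomog mdeg (sa l - sb m) (X l m) else 0).
  move=> l m; rewrite mxE; case: ifP => [le|_]; [right|by left].
  by split=> //; apply: pihomogP.
apply/matrixP => l j; have [gt|le] := ltnP (sa l) (sc j).
  have [->|[]] := hM l j; last by rewrite leqNgt gt.
  rewrite mxE big1 // => m _; rewrite mxE; case: ifP => [le|]; last by rewrite mul0r.
  by have [->|[]] := hD m j; [rewrite mulr0|rewrite leqNgt (leq_ltn_trans le)].
have <- : pihomog mdeg (sa l - sc j) (M l j) = M l j.
  by have [->|[_ /pihomog_dE->]] := hM l j; rewrite ?raddf0.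
rewrite MXD !mxE raddf_sum /=; apply: eq_bigr => m _; rewrite mxE.
have [->|[le' hDm]] := hD m j; first by rewrite !mulr0 raddf0.
rewrite (pihomogM _ _ hDm) leq_subLR subnKC //.
case: leqP => [ll|]; last by rewrite mul0r.
by congr (pihomog _ _ _ * _); lia.
Qed.

Lemma mcoeff0M (p q : R) : (p * q)@_0%MM = p@_0%MM * q@_0%MM.
Proof. exact: (rmorphM (mcoeff 0%MM)). Qed.

(** [const_mx 1] plays the identity between the modules in position 0, whose ranks equal 1 only
    propositionally. *)
Lemma mul_const_mx1 a b r (M : 'M[R]_(a, r)) i (j : 'I_b) m :
  r = 1%N -> (M *m const_mx 1) i j = M i m.
Proof.
by move=> r1; case: _ / (esym r1) M m => M m; rewrite mxE big_ord1 mxE mulr1 !ord1.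
Qed.

Section Lift.
Variables (I : R -> Prop) (F G : graded_free_complex k n).
Hypotheses (resF : graded_free_resolution I F) (resG : graded_free_resolution I G).

Lemma res_mulmx0 i : dm F i.+1 *m dm F i = 0.
Proof.
have [_ [_ [_ [_ [_ [ex _]]]]]] := resF.
apply/row_matrixP => l; rewrite row_mul row0; apply/ex.
by exists (delta_mx 0 l); rewrite rowE.
Qed.

Lemma res_exact_mx i a (M : 'M[R]_(a, rk F i.+1)) :
  M *m dm F i = 0 -> exists X, M = X *m dm F i.+1.
Proof.
move=> M0; have [_ [_ [_ [_ [_ [ex _]]]]]] := resF.
have [X XE] : exists X : 'I_a -> 'rV[R]_(rk F i.+2),
    forall l, row l M = X l *m dm F i.+1.
  apply: (@fin_all_exists _ _ (fun l w => row l M = w *m dm F i.+1)) => l; apply/ex.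
  by rewrite -row_mul M0 row0.
exists (\matrix_l X l); apply/row_matrixP => l.
by rewrite row_mul rowK XE.
Qed.

(** The entries of [dm F 0] lie in [I], which is also the image of [dm G 0]. *)
Lemma res_lift0 : exists X, dm F 0 *m const_mx 1 = X *m dm G 0.
Proof.
have [F01 [_ [_ [_ [_ [_ IF]]]]]] := resF; have [_ [_ [_ [_ [_ [_ IG]]]]]] := resG.
have m0 : 'I_(rk F 0) by rewrite F01; exact: ord0.
have [X XE] : exists X : 'I_(rk F 1) -> 'rV[R]_(rk G 1),
    forall l j, (X l *m dm G 0) 0 j = dm F 0 l m0.
  apply: (@fin_all_exists _ _
    (fun l (w : 'rV_ _) => forall j, (w *m dm G 0) 0 j = dm F 0 l m0)) => l.
  apply/IG/IF; exists (delta_mx 0 l) => j; rewrite -rowE mxE.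
  by congr (dm F 0 l _); move: m0 j; rewrite F01 => m0 j; rewrite !ord1.
exists (\matrix_l X l); apply/matrixP => l j.
rewrite (mul_const_mx1 _ _ _ m0) // -(XE l j).
by rewrite -[in LHS](rowK X l) -row_mul mxE.
Qed.

End Lift.

(* [phi] and [psi] are the [i]-th components of lifts of the identity in both
   directions, [E] and [s *m dm F i] the two summands of a homotopy between
   [phi *m psi] and the identity. *)
Lemma comparison (I : R -> Prop) (F G : graded_free_complex k n) i :
    graded_free_resolution I F -> graded_free_resolution I G -> minimal_res F ->
  exists (phi : 'M[R]_(rk F i, rk G i)) (psi : 'M[R]_(rk G i, rk F i))
         (s : 'M[R]_(rk F i, rk F i.+1)) (E : 'M[R]_(rk F i)),
  [/\ homog_mx (@sh _ _ F i) (@sh _ _ G i) phi,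
      phi *m psi = 1%:M + E + s *m dm F i,
      dm F i *m E = 0 /\ (forall l m, (E l m)@_0%MM = 0),
      exists X, dm F i *m phi = X *m dm G i &
      exists Y, dm G i *m psi = Y *m dm F i].
Proof.
move=> resF resG minF.
have [F01 [_ [_ [shF [hF _]]]]] := resF; have [G01 [_ [_ [shG [hG _]]]]] := resG.
elim: i => [|i [phi [psi [s [E [hphi phi_psi [dE E0] [X phiX] [Y psiY]]]]]]].
  exists (const_mx 1), (const_mx 1), 0, 0; split.
  - by move=> l m; right; rewrite mxE shF shG; split=> //; apply: dhomog1.
  - rewrite addr0 mul0mx addr0; apply/matrixP => l m.
    rewrite !mxE; under eq_bigr do rewrite !mxE mulr1.
    rewrite sumr_const card_ord G01; suff -> : l = m by rewrite eqxx.
    by move: l m; rewrite F01 => l m; rewrite !ord1.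
  - by split=> [|l m]; rewrite ?mulmx0 ?mxE ?mcoeff0.
  - exact: res_lift0 resF resG.
  - exact: res_lift0 resG resF.
have [Z hZ phiZ] : exists2 Z : 'M[R]_(rk F i.+1, rk G i.+1),
    homog_mx (@sh _ _ F i.+1) (@sh _ _ G i.+1) Z & dm F i *m phi = Z *m dm G i.
  exact: (homog_mx_lift (homog_mx_mul (hF i) hphi) (hG i) phiX).
(* By the identity for [phi *m psi], the product of the left side with [dm F i] reduces to
   [dm F i *m E], which is zero; exactness then supplies the next homotopy. *)
have [s' s'E] : exists s', Z *m Y - 1%:M - dm F i *m s = s' *m dm F i.+1.
  apply: (res_exact_mx resF); rewrite !mulmxBl mul1mx -!mulmxA -psiY [Z *m _]mulmxA -phiZ.
  rewrite -mulmxA phi_psi !mulmxDr mulmx1 dE addr0.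
  by rewrite [X in X - _ - _]addrC addrK subrr.
exists Z, Y, s', (dm F i *m s); split=> //.
- by rewrite -s'E addrC [1%:M + _]addrC addrA !subrK.
- split=> [|l m]; first by rewrite mulmxA (res_mulmx0 resF) mul0mx.
  rewrite mxE raddf_sum big1 // => j _ /=.
  by rewrite mcoeff0M minF mul0r.
- apply: (res_exact_mx resG).
  by rewrite -mulmxA -phiZ mulmxA (res_mulmx0 resF) mul0mx.
- apply: (res_exact_mx resF).
  by rewrite -mulmxA -psiY mulmxA (res_mulmx0 resG) mul0mx.
Qed.

(** Modulo the variables, [phi *m psi] is the identity, since the homotopy terms have no constant
    part. Hence row [l] of [phi] has an entry with nonzero constant term, and homogeneity makes the
    two shifts equal. *)
Lemma minimal_shift (I : R -> Prop) (F G : graded_free_complex k n) i (l : 'I_(rk F i)) :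
    graded_free_resolution I F -> graded_free_resolution I G -> minimal_res F ->
  exists m : 'I_(rk G i), sh m = sh l.
Proof.
move=> resF resG minF.
have [phi [psi [s [E [hphi phi_psi [_ E0] _ _]]]]] := comparison i resF resG minF.
have : ((phi *m psi) l l)@_0%MM = 1.
  rewrite phi_psi !mxE eqxx !mcoeffD E0 addr0 mcoeff1 eqxx raddf_sum big1 ?addr0 //.
  by move=> j _ /=; rewrite mcoeff0M minF mulr0.
have [/existsP[m phim] _|] := boolP [exists m, (phi l m)@_0%MM != 0].
  exists m; have [phi0|[le hom]] := hphi l m; first by rewrite phi0 mcoeff0 eqxx in phim.
  have /(dhomog_mf hom) : 0%MM \in msupp (phi l m) by rewrite mcoeff_msupp.
  by rewrite /= mdeg0 => /esym/eqP; rewrite subn_eq0 => ge; apply/eqP; rewrite eqn_leq le.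
rewrite negb_exists => /forallP phi0; rewrite mxE raddf_sum /= big1 => [/esym/eqP|m _].
  by rewrite oner_eq0.
by have /negPn/eqP phi0m := phi0 m; rewrite mcoeff0M phi0m mul0r.
Qed.

Lemma res_len_le (I : R -> Prop) (F G : graded_free_complex k n) :
    graded_free_resolution I F -> graded_free_resolution I G -> minimal_res F ->
  (len F <= len G)%N.
Proof.
move=> resF resG minF; have [_ [_ [rkF _]]] := resF; have [_ [rkG _]] := resG.
have [[m ltm] _] := minimal_shift (Ordinal rkF) resF resG minF.
by rewrite leqNgt; apply/negP => /rkG rk0; rewrite rk0 in ltm.
Qed.

Lemma res_reg_le (I : R -> Prop) (F G : graded_free_complex k n) :
    graded_free_resolution I F -> graded_free_resolution I G -> minimal_res F ->
  (res_reg F <= res_reg G)%N.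
Proof.
move=> resF resG minF; apply/bigmax_leqP => i _; apply/bigmax_leqP => l _.
have [m <-] := minimal_shift l resF resG minF.
have lti : (i < (len G).+1)%N.
  by apply: leq_trans (ltn_ord i) _; rewrite ltnS; exact: res_len_le resF resG minF.
apply: leq_trans (leq_bigmax_cond (Ordinal lti) _) => //=.
exact: (leq_bigmax_cond (F := fun m : 'I_(rk G i) => sh m - i)%N m).
Qed.

End Comparison.

(** * The chain complex of a simplex *)

Section Simplex.
Variables (K : comNzRingType) (L : lmodType K) (N : nat).
Implicit Types (S T U W : {set 'I_N}) (V : {set 'I_N} -> L).

Definition pos (w : 'I_N) S := #|[set u in S | u < w]%N|.
(** The simplicial boundary read coefficientwise: the value at [T] comes from the faces having [T]
    as a facet. Chains are functions on all sets, which avoids dependent indices. *)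
Definition boundary W V T : L :=
  \sum_(w in W | w \notin T) (-1) ^+ pos w T *: V (w |: T).
Definition cone w V S : L := if w \in S then (-1) ^+ pos w (S :\ w) *: V (S :\ w) else 0.

Lemma posU1 w x S : x \notin S -> pos w (x |: S) = ((x < w) + pos w S)%N.
Proof.
move=> xS; rewrite /pos; case: (ltnP x w) => [xw|wx].
  rewrite (_ : [set u in x |: S | u < w]%N = x |: [set u in S | u < w]%N).
    by rewrite cardsU1 inE (negPf xS).
  by apply/setP => u; rewrite !inE; case: eqP => [->|].
congr #|pred_of_set _|; apply/setP => u; rewrite !inE.
by case: eqP => [->|] //=; rewrite ltnNge wx andbF.
Qed.

Lemma posU1_sign w x S : w != x -> w \notin S -> x \notin S ->
  (-1) ^+ pos w (x |: S) * (-1) ^+ pos x (w |: S) =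
  - ((-1) ^+ pos w S * (-1) ^+ pos x S) :> K.
Proof.
move=> wx wS xS; rewrite !posU1 // !exprD.
have [lt|gt|eq] := ltngtP w x; last by rewrite (val_inj eq) eqxx in wx.
  by rewrite mul1r expr1 mulN1r mulrN.
by rewrite mul1r expr1 mulN1r mulNr.
Qed.

Lemma boundary_sum W (J : finType) (P : pred J) (F : J -> {set 'I_N} -> L) T :
  boundary W (fun S => \sum_(j | P j) F j S) T = \sum_(j | P j) boundary W (F j) T.
Proof.
rewrite [RHS]exchange_big; apply: eq_bigr => w _; exact: scaler_sumr.
Qed.

Lemma eq_boundary W V V' T :
    (forall w, w \in W -> w \notin T -> V (w |: T) = V' (w |: T)) ->
  boundary W V T = boundary W V' T.
Proof. by move=> eqV; apply: eq_bigr => w /andP[Ww Tw]; rewrite eqV. Qed.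

(** Adding [w] then [u] and adding [u] then [w] reach the same set with opposite signs. *)
Lemma boundary_boundary W V T : boundary W (boundary W V) T = 0.
Proof.
pose A := [pred w | (w \in W) && (w \notin T)].
pose f (w u : 'I_N) := ((-1) ^+ pos w T * (-1) ^+ pos u (w |: T)) *: V (u |: (w |: T)).
have fN w u : A w -> A u -> w != u -> f w u = - f u w.
  move=> /andP[_ Tw] /andP[_ Tu] wu; rewrite /f setUCA -scaleNr; congr (_ *: _).
  rewrite !posU1 // !exprD; case: (ltngtP w u) => [lt|gt|eq] /=.
  - by rewrite expr1 expr0; ring.
  - by rewrite expr1 expr0; ring.
  - by rewrite (val_inj eq) eqxx in wu.
transitivity (\sum_(w | A w) \sum_(u | A u && (u != w)) f w u).
  apply: eq_bigr => w Aw; rewrite scaler_sumr; apply: eq_big => [u|u _].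
    by rewrite !inE negb_or andbA andbAC.
  by rewrite scalerA.
transitivity (\sum_(w | A w) \sum_(u | A u && (u < w)%N) f w u +
              \sum_(w | A w) \sum_(u | A u && (w < u)%N) f w u).
  rewrite -big_split; apply: eq_bigr => w Aw; rewrite (bigID (fun u : 'I_N => u < w)%N) /=.
  congr (_ + _); apply: eq_bigl => u; rewrite -!andbA; do !congr (_ && _);
    by rewrite -val_eqE /=; case: ltngtP.
rewrite (exchange_big_dep A) /= => [|w u _ /andP[] //].
rewrite -big_split big1 // => u Au /=.
rewrite (eq_bigl (fun w => A w && (u < w)%N)); last first.
  by move=> w; rewrite Au.
rewrite -big_split big1 // => w /andP[Aw uw] /=.
by rewrite fN ?addNr //; apply: contraTneq uw => ->; rewrite ltnn.
Qed.

(* Coning with apex [w] is a contracting homotopy of the simplex. *)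
Lemma boundary_cone W w V T : w \in W -> (forall U, boundary W V U = 0) ->
  boundary W (cone w V) T = V T.
Proof.
move=> Ww V0; rewrite /boundary /cone; have [Tw|Tw] := boolP (w \in T); last first.
  rewrite (bigD1 w) ?Ww //= big1 ?addr0 => [|u /andP[/andP[Wu Tu] uw]].
    by rewrite setU11 setU1K // scalerA -expr2 sqrr_sign scale1r.
  by rewrite !inE eq_sym (negPf uw) (negPf Tw) scaler0.
set U := T :\ w; have Uw : w \notin U by rewrite !inE eqxx.
have TE : T = w |: U by rewrite setD1K.
(* The vanishing boundary at [U] expresses [V T] through the values at the sets [u |: U], which are
   those the cone reads at [u |: T]. *)
have /eqP := V0 U; rewrite /boundary (bigD1 w) ?Ww //= -TE addrC addr_eq0.
move=> /eqP/(congr1 (fun x => - ((-1) ^+ pos w U *: x))).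
rewrite scalerN opprK [RHS]scalerA -expr2 sqrr_sign scale1r => <-.
rewrite scaler_sumr -sumrN; apply: eq_big => [u|u /andP[Wu Tu]].
  rewrite TE !inE; case: eqP => [->|] /=; first by rewrite !andbF.
  by rewrite andbT.
have uw : u != w by apply: contraNneq Tu => ->.
have Uu : u \notin U by rewrite !inE negb_and Tu orbT.
have -> : (u |: T) :\ w = u |: U.
  by rewrite TE setUCA setU1K // in_setU1 negb_or eq_sym uw.
rewrite !inE Tw orbT !scalerA TE posU1_sign // scaleNr; congr (- (_ *: _)).
by rewrite mulrC.
Qed.

End Simplex.

(** * Monomial parts of polynomials and squarefree monomials *)

Section MonomialFilter.
Variables (k : fieldType) (n : nat).
Local Notation R := {mpoly k[n]}.

(** Splits a chain by its monomials; being linear over [k], it commutes with [boundary], whose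
    coefficients are signs. *)
Definition mfilter (P : pred 'X_{1..n}) (p : R) : R :=
  \sum_(m <- msupp p | P m) p@_m *: 'X_[m].

Lemma mcoeff_mfilter P p m : (mfilter P p)@_m = if P m then p@_m else 0.
Proof.
rewrite raddf_sum /=; under eq_bigr do rewrite mcoeffZ mcoeffX.
have [pm|pm] := boolP (m \in msupp p).
  rewrite big_mkcond (bigD1_seq m) ?msupp_uniq //= eqxx mulr1 big1 ?addr0 // => i im.
  by rewrite (negPf im) mulr0 if_same.
rewrite (memN_msupp_eq0 pm) if_same big_seq_cond big1 // => i /andP[pi _].
by case: eqP => [im|]; rewrite ?mulr0 // -im pi in pm *.
Qed.

Lemma mfilter_is_linear P : linear (mfilter P).
Proof.
move=> c p q; apply/mpolyP => m; rewrite mcoeffD mcoeffZ !mcoeff_mfilter mcoeffD mcoeffZ.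
by case: ifP; rewrite ?mulr0 ?addr0.
Qed.
HB.instance Definition _ P :=
  GRing.isLinear.Build k R R *:%R (mfilter P) (mfilter_is_linear P).

Definition Xset (B : {set 'I_n}) : R := 'X_[mesym1 B].

Lemma Xset_neq0 B : Xset B != 0.
Proof. by rewrite -msupp_eq0 msuppX. Qed.

Lemma Xset0 : Xset set0 = 1.
Proof. by rewrite /Xset mesym1_set0 mpolyX0. Qed.

Lemma Xset_prod B : Xset B = \prod_(j in B) 'X_j.
Proof.
rewrite /Xset mpolyXE_id [RHS]big_mkcond; apply: eq_bigr => i _.
by rewrite mnmE; case: (i \in B).
Qed.

Lemma XsetD (B C : {set 'I_n}) : C \subset B -> Xset C * Xset (B :\: C) = Xset B.
Proof.
move=> /subsetP CB; rewrite /Xset -mpolyXD; congr 'X_[_]; apply/mnmP => i.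
rewrite mnmDE !mnmE in_setD; have := CB i; case: (i \in C) => [->|_] //=.
Qed.

Lemma msupp_XsetM B (q : R) m : m \in msupp (Xset B * q) -> (mesym1 B <= m)%MM.
Proof. by rewrite mulrC (perm_mem (msuppMX _ _)) => /mapP[m' _ ->]; apply: lem_addr. Qed.

Lemma Xset_dvd B (p : R) :
  (forall m, m \in msupp p -> (mesym1 B <= m)%MM) -> exists q, p = Xset B * q.
Proof.
move=> Bp; exists (\sum_(m <- msupp p) p@_m *: 'X_[m - mesym1 B]).
rewrite {1}[p]mpolyE mulr_sumr !big_seq; apply: eq_bigr => m /Bp Bm.
by rewrite -scalerAr -mpolyXD addmC submK.
Qed.

Lemma lem_mesym1 (B : {set 'I_n}) (m : 'X_{1..n}) :
  reflect (forall j, j \in B -> m j != 0%N) (mesym1 B <= m)%MM.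
Proof.
apply: (iffP mnm_lepP) => [Bm j jB|Bm j].
  by have := Bm j; rewrite mnmE jB lt0n.
by rewrite mnmE; case: (boolP (j \in B)) => // /Bm; rewrite lt0n.
Qed.

End MonomialFilter.

(** * The Taylor resolution of squarefree monomials *)

Section Taylor.
Variables (k : fieldType) (n N : nat) (W : {set 'I_N}) (A : 'I_N -> {set 'I_n}).
Local Notation R := {mpoly k[n]}.
Local Notation Xset := (Xset k).
Implicit Types (S T : {set 'I_N}).

Definition faces i : {set {set 'I_N}} := [set S : {set 'I_N} | (S \subset W) && (#|S| == i)].
Definition lcm_set S : {set 'I_n} := \bigcup_(w in S) A w.

(** The Taylor differential: at most one [w] contributes, and the monomial is the quotient of the
    two lcms. *)
Definition taylor_dm i : 'M[R]_(#|faces i.+1|, #|faces i|) :=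
  \matrix_(l < #|faces i.+1|, m < #|faces i|) let S := enum_val l in let T := enum_val m in
    \sum_(w in S | S :\ w == T) (-1) ^+ pos w T *: Xset (lcm_set S :\: lcm_set T).

Definition taylor : graded_free_complex k n :=
  @GFC k n #|W| (fun i => #|faces i|) (fun i l => #|lcm_set (enum_val l)|) taylor_dm.

Lemma facesU1 w T i : w \in W -> w \notin T -> (w |: T \in faces i.+1) = (T \in faces i).
Proof. by move=> Ww Tw; rewrite !inE subUset sub1set Ww cardsU1 Tw. Qed.

Lemma lcm_setS S T : T \subset S -> lcm_set T \subset lcm_set S.
Proof.
move=> /subsetP TS; apply/bigcupsP => w /TS Sw; exact: bigcup_sup.
Qed.

(** Extension by zero to all sets; the sum has at most one term. *)
Definition ext i (v : 'rV[R]_#|faces i|) S : R := \sum_(l | enum_val l == S) v 0 l.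

Lemma ext_enum_val i (v : 'rV[R]_#|faces i|) l : ext v (enum_val l) = v 0 l.
Proof.
by apply: big_pred1 => m; rewrite (inj_eq enum_val_inj).
Qed.

Lemma ext_out i (v : 'rV[R]_#|faces i|) S : S \notin faces i -> ext v S = 0.
Proof.
by move=> nS; apply: big_pred0 => l; apply: contraNF nS => /eqP<-; apply: enum_valP.
Qed.

(* Scaling the component at [S] by the lcm of its generators embeds the Taylor
   complex into the chain complex of a simplex with coefficients in [R]. *)
Definition scaled i (v : 'rV[R]_#|faces i|) S : R := Xset (lcm_set S) * ext v S.

Lemma scaled_boundary i (v : 'rV[R]_#|faces i.+1|) (m : 'I_#|faces i|) :
  Xset (lcm_set (enum_val m)) * (v *m taylor_dm i) 0 m =
  boundary W (scaled v) (enum_val m).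
Proof.
set T := enum_val m; rewrite mxE mulr_sumr.
pose f w (l : 'I_#|faces i.+1|) := (-1) ^+ pos w T *: (Xset (lcm_set (enum_val l)) * v 0 l).
transitivity (\sum_(l < #|faces i.+1|) \sum_(w in enum_val l | enum_val l :\ w == T) f w l).
  apply: eq_bigr => l _; rewrite mxE -/T !mulr_sumr; apply: eq_bigr => w /andP[Sw /eqP ST].
  rewrite -!scalerAr; congr (_ *: _); rewrite mulrCA XsetD 1?mulrC //.
  by rewrite lcm_setS // -ST subD1set.
rewrite (exchange_big_dep predT) //= [RHS]big_mkcond; apply: eq_bigr => w _.
case: ifPn => [/andP[Ww Tw]|WTw].
  rewrite /scaled /ext mulr_sumr scaler_sumr; apply: eq_big => [l|l /andP[Sw /eqP ST]].
    apply/andP/eqP => [[Sw /eqP<-]|->]; first by rewrite setD1K.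
    by rewrite setU11 setU1K.
  by rewrite /f -ST setD1K.
apply: big_pred0 => l; apply/andP => -[Sw /eqP ST]; case/negP: WTw.
have := enum_valP l; rewrite inE => /andP[/subsetP-> // _].
by rewrite -ST !inE eqxx.
Qed.

Lemma taylor_dm_dm i (v : 'rV[R]_#|faces i.+2|) : v *m taylor_dm i.+1 *m taylor_dm i = 0.
Proof.
apply/rowP => m; rewrite [RHS]mxE; apply: (mulfI (Xset_neq0 k (lcm_set (enum_val m)))).
rewrite scaled_boundary mulr0 -(boundary_boundary W (scaled v) (enum_val m)).
apply: eq_boundary => w Ww Tw.
have Sw : w |: enum_val m \in faces i.+1 by rewrite facesU1 // enum_valP.
rewrite -(enum_rankK_in Sw Sw) -scaled_boundary /scaled; congr (_ * _).
exact: ext_enum_val.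
Qed.

(** At a fixed monomial [m], the scaled chains live on the simplex of the generators dividing [m],
    which is contracted by coning from one of them. This is done for all monomials at once, grouped
    by apex. *)
Lemma taylor_exact i (v : 'rV[R]_#|faces i.+1|) :
  v *m taylor_dm i = 0 -> exists w, v = w *m taylor_dm i.+1.
Proof.
move=> v0; pose V := scaled v.
pose first m := [pick w in W | (mesym1 (A w) <= m)%MM].
pose F w S : R := mfilter (fun m => first m == Some w) (V S).
have Vout S : S \notin faces i.+1 -> V S = 0.
  by move=> nS; rewrite /V /scaled ext_out // mulr0.
have bV T : boundary W V T = 0.
  have [fT|nT] := boolP (T \in faces i).
    by rewrite -(enum_rankK_in fT fT) -scaled_boundary v0 mxE mulr0.
  by apply: big1 => w /andP[Ww Tw]; rewrite Vout ?scaler0 // facesU1.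
have bF w T : boundary W (F w) T = 0.
  transitivity (mfilter (fun m => first m == Some w) (boundary W V T)).
    by rewrite linear_sum; apply: eq_bigr => u _; rewrite linearZ.
  by rewrite bV linear0.
(* A monomial of [V S] is divisible by every generator in the nonempty [S], so it is assigned an
   apex and no part of [V] is lost. *)
have VF S : V S = \sum_(w in W) F w S.
  have [fS|nS] := boolP (S \in faces i.+1); last first.
    by rewrite Vout // big1 // => w _; rewrite /F Vout // linear0.
  apply/mpolyP => m; rewrite raddf_sum /=.
  under eq_bigr do rewrite mcoeff_mfilter.
  have [Vm|/memN_msupp_eq0->] := boolP (m \in msupp (V S)); last first.
    by rewrite big1 // => w _; rewrite if_same.
  rewrite /first; case: pickP => [w /andP[Ww _]|noW].
    rewrite (bigD1 w) //= eqxx big1 ?addr0 // => u /andP[_ uw].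
    by rewrite ifN // eq_sym; apply: contra uw => /eqP[->].
  move: fS; rewrite inE => /andP[/subsetP SW /eqP cS].
  have /card_gt0P[w Sw] : (0 < #|S|)%N by rewrite cS.
  have /negP[] := noW w; rewrite /= SW //=; apply: lepm_trans (msupp_XsetM Vm).
  apply/lem_mesym1 => j Aj; rewrite mnmE.
  by rewrite (_ : j \in _) //; apply/bigcupP; exists w.
pose Z S : R := \sum_(w in W) cone w (F w) S.
have bZ T : boundary W Z T = V T.
  by rewrite boundary_sum VF; apply: eq_bigr => w Ww; apply: boundary_cone.
have Zout S : S \notin faces i.+2 -> Z S = 0.
  move=> nS; apply: big1 => w Ww; rewrite /cone; case: ifP => // Sw.
  rewrite /F Vout ?linear0 ?scaler0 //; apply: contra nS => fS.
  by rewrite -(setD1K Sw) facesU1 // !inE eqxx.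
(* Undoing the scaling needs [Z S] divisible by the lcm of [S]: a monomial coned from [w] is
   divisible by [A w] by choice of the apex, and by the generators in [S :\ w] through [V]. *)
have [z zE] : exists z : {set 'I_N} -> R, forall S, Z S = Xset (lcm_set S) * z S.
  apply: (@fin_all_exists _ _ (fun S z => Z S = Xset (lcm_set S) * z)) => S.
  apply: Xset_dvd => m; apply: contraTT => nle; rewrite mcoeff_msupp negbK.
  rewrite raddf_sum big1 //= => w Ww; rewrite /cone; case: ifP => [Sw|_]; last exact: mcoeff0.
  rewrite mcoeffZ mcoeff_mfilter; case: eqP => [|_]; last exact: mulr0.
  rewrite /first; case: pickP => // w' /andP[_ Am] [ww]; rewrite {w'}ww in Am.
  rewrite (memN_msupp_eq0 _) ?mulr0 //; apply: contra nle => /msupp_XsetM Um.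
  apply/lem_mesym1 => j /bigcupP[u Su Auj].
  have [uw|uw] := eqVneq u w; first by move/lem_mesym1: Am; apply; rewrite -uw.
  by move/lem_mesym1: Um; apply; apply/bigcupP; exists u; rewrite // !inE uw.
exists (\row_l z (enum_val l)); apply/rowP => l.
apply: (mulfI (Xset_neq0 k (lcm_set (enum_val l)))).
rewrite scaled_boundary -(ext_enum_val v) -[LHS]/(V (enum_val l)) -bZ.
apply: eq_boundary => w _ _; have [fS|nS] := boolP (w |: enum_val l \in faces i.+2).
  by rewrite -(enum_rankK_in fS fS) zE /scaled ext_enum_val mxE.
by rewrite Zout // /scaled ext_out ?mulr0.
Qed.

Lemma card_faces0 : #|faces 0| = 1%N.
Proof.
rewrite (_ : faces 0 = [set set0]) ?cards1 //; apply/setP => S.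
by rewrite !inE cards_eq0; case: eqP => [->|]; rewrite ?sub0set ?andbF.
Qed.

Lemma enum_faces0 (l : 'I_#|faces 0|) : enum_val l = set0.
Proof. by have := enum_valP l; rewrite inE cards_eq0 => /andP[_ /eqP]. Qed.

Lemma lcm_set0 : lcm_set set0 = set0.
Proof. exact: big_set0. Qed.

Lemma taylor_resolution (I : R -> Prop) :
    (forall p, I p <-> exists c : 'I_N -> R, p = \sum_(w in W) c w * Xset (A w)) ->
  graded_free_resolution I taylor.
Proof.
move=> IE; split; first exact: card_faces0.
split=> [i /= lti|].
  apply/eqP; rewrite cards_eq0; apply/eqP/setP => S; rewrite !inE.
  apply/negP => /andP[/subset_leq_card + /eqP cS]; by rewrite cS leqNgt lti.
split; first by apply/card_gt0P; exists W; rewrite inE subxx eqxx.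
split=> [l /=|]; first by rewrite enum_faces0 lcm_set0 cards0.
split=> [i l m /=|].
  rewrite mxE; set S := enum_val l; set T := enum_val m.
  have [/existsP[w /andP[Sw /eqP ST]]|none] := boolP [exists w, (w \in S) && (S :\ w == T)].
    have TS : lcm_set T \subset lcm_set S by rewrite lcm_setS // -ST subD1set.
    right; split; first exact: subset_leq_card.
    apply: rpred_sum => u _; apply: rpredZ; rewrite dhomogX /= mdeg_mesym1.
    by rewrite cardsD (setIidPr TS).
  by left; apply: big_pred0 => w; apply: contraNF none => Sw; apply/existsP; exists w.
split=> [i v|p].
  split; first exact: taylor_exact.
  by case=> w ->; apply: taylor_dm_dm.
have l0 : 'I_#|faces 0| by rewrite card_faces0; exact: ord0.
have row0 (v : 'rV[R]_#|faces 1|) (j : 'I_#|faces 0|) :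
    (v *m taylor_dm 0) 0 j = \sum_(w in W) ext v [set w] * Xset (A w).
  have := scaled_boundary v j; rewrite enum_faces0 lcm_set0 Xset0 mul1r => ->.
  apply: eq_big => [w|w _]; first by rewrite inE andbT.
  rewrite /scaled setU0 /lcm_set big_set1 mulrC /pos (_ : [set _ in _ | _] = set0).
    by rewrite cards0 scale1r.
  by apply/setP => u; rewrite !inE.
rewrite IE; split=> [[c ->]|[v vE]]; last first.
  by exists (fun w => ext v [set w]); rewrite -(vE l0) row0.
(* A face of size one is a singleton [[set w]], where the inner sum is just [c w]. *)
exists (\row_(l < #|faces 1|) \sum_(w in enum_val l) c w) => j.
rewrite row0; apply: eq_bigr => w Ww.
have fw : [set w] \in faces 1 by rewrite inE sub1set Ww cards1.
congr (_ * _); rewrite -{1}(enum_rankK_in fw fw) ext_enum_val mxE.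
by rewrite enum_rankK_in // big_set1.
Qed.

(** Dropping [w] from a face loses its private variable from the lcm, so the quotient monomial is
    not 1. *)
Lemma taylor_minimal :
    (forall w, w \in W -> exists2 x, x \in A w &
       forall u, u \in W -> x \in A u -> u = w) ->
  minimal_res taylor.
Proof.
move=> priv i l m; rewrite mxE raddf_sum big1 //= => w /andP[Sw /eqP ST].
rewrite mcoeffZ mcoeffX; case: eqP => [/(congr1 (@mdeg _))|]; last by rewrite mulr0.
have SW : enum_val l \subset W by have := enum_valP l; rewrite inE => /andP[].
rewrite mdeg_mesym1 mdeg0 => /eqP; rewrite cards_eq0 => /eqP/setP.
have [x Ax xE] := priv w (subsetP SW _ Sw).
have lx : x \in lcm_set (enum_val l) by apply/bigcupP; exists w.
move=> /(_ x); rewrite !inE lx andbT => /negbFE/bigcupP[u]; rewrite -ST !inE => /andP[uw Su] Au.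
by rewrite (xE u) ?eqxx // in uw; apply: subsetP Su.
Qed.

End Taylor.

(** * The vertex cover [centers] and the matching number *)

Section Graph.
Variables (n : nat) (e : rel 'I_n).
Hypotheses (simple_e : simple_graph e) (indepV3 : independent e (V3 e)).

Let symE : ssrbool.symmetric e. Proof. by case: simple_e. Qed.

Lemma V1_nbr_eq x y z : x \in V1 e -> e x y -> e x z -> y = z.
Proof.
rewrite inE => /cards1P[t xt] exy exz.
have : y \in nbhd e x by rewrite inE.
have : z \in nbhd e x by rewrite inE.
by rewrite [nbhd e x]xt !inE => /eqP-> /eqP->.
Qed.

Lemma V1_nbhd x y : x \in V1 e -> e x y -> nbhd e x = [set y].
Proof.
move=> V1x exy; apply/setP => z; rewrite !inE; apply/idP/eqP => [|-> //].
by move=> exz; apply: V1_nbr_eq exz exy.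
Qed.

Lemma nbr_deg_ge2 x y : e x y -> x \notin V1 e -> (2 <= deg e x)%N.
Proof.
move=> exy; rewrite inE.
have : (0 < deg e x)%N by apply/card_gt0P; exists y; rewrite inE.
by case: (deg e x) => [|[]].
Qed.

Lemma V2_deg x : x \in V2 e -> (2 <= deg e x)%N.
Proof. by rewrite inE => /andP[]. Qed.

Lemma V2_V1 x : x \in V2 e -> x \notin V1 e.
Proof. by move/V2_deg; rewrite inE; case: (deg e x) => [|[]]. Qed.

Lemma V1'P x y : e x y -> (x \in V1' e) = (x \in V1 e) && (y \in V1 e).
Proof.
move=> exy; rewrite !in_set; case: eqP => //= deg1.
by rewrite (@V1_nbhd x y) ?sub1set ?inE ?deg1 ?eqxx.
Qed.

Definition edge_reps := [set x in V1' e | [forall y, e x y ==> (x < y)%N]].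

(* One endpoint is taken from every component that is a single edge. *)
Definition centers : {set 'I_n} := V2 e :|: edge_reps.

Lemma edge_repsP x y : e x y ->
  (x \in edge_reps) = [&& x \in V1 e, y \in V1 e & (x < y)%N].
Proof.
move=> exy; rewrite in_set (V1'P exy) -andbA.
have [V1x|//] := boolP (x \in V1 e); rewrite !andTb; congr (_ && _).
apply/forallP/idP => [/(_ y)|ltxy z]; first by rewrite exy.
by apply/implyP => exz; rewrite -(V1_nbr_eq V1x exy exz).
Qed.

(** Every edge has an endpoint in [centers]. Two endpoints of degree one form a component, whose
    smaller vertex was chosen; a single one puts the other endpoint in [V2]; with none, independence
    of [V3] leaves an endpoint in [V2]. *)
Lemma notin_centers_nbr w y : w \notin centers -> e w y -> y \in centers.
Proof.
move=> Cw ewy; have eyw : e y w by rewrite symE.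
have nw : w != y by apply: contraTneq ewy => ->; case: simple_e => _ ->.
move: Cw; rewrite !in_setU (edge_repsP ewy) (edge_repsP eyw) negb_or.
have [V1w|V1w] := boolP (w \in V1 e); have [V1y|V1y] := boolP (y \in V1 e) => /=.
- by rewrite -leqNgt leq_eqVlt eq_sym val_eqE (negPf nw) /= => /andP[_ ->]; rewrite orbT.
- move=> _; rewrite orbF inE (nbr_deg_ge2 eyw) //=.
  by apply/set0Pn; exists w; rewrite inE V1w inE eyw.
- rewrite andbT inE (nbr_deg_ge2 ewy) //= => /negP[].
  by apply/set0Pn; exists y; rewrite inE V1y inE ewy.
rewrite andbT orbF !inE (nbr_deg_ge2 eyw) // (nbr_deg_ge2 ewy) //= => V3w.
apply/negP => V3y; move: indepV3 => /forall_inP/(_ w)/=.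
rewrite inE (nbr_deg_ge2 ewy) // (negbNE V3w) => /(_ isT)/forall_inP/(_ y).
by rewrite inE (nbr_deg_ge2 eyw) // V3y ewy => /(_ isT).
Qed.

Definition leaf v : 'I_n := odflt v [pick l | (l \notin centers) && (nbhd e l == [set v])].

(** A vertex of [V2] has a neighbour of degree one, and a chosen endpoint of an isolated edge has
    its partner; neither is in [centers]. So the default in [leaf] is not reached at a center. *)
Lemma leafP v : v \in centers -> leaf v \notin centers /\ nbhd e (leaf v) = [set v].
Proof.
move=> Cv; suff [l Cl nl] : exists2 l, l \notin centers & nbhd e l = [set v].
  rewrite /leaf; case: pickP => [l' /andP[-> /eqP->] //|/(_ l)].
  by rewrite Cl nl eqxx.
move: Cv; rewrite in_setU => /orP[V2v|].
  have V1v := V2_V1 V2v; move: V2v; rewrite inE => /andP[_ /set0Pn[l]].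
  rewrite in_setI inE => /andP[evl V1l]; have elv : e l v by rewrite symE.
  exists l; last exact: V1_nbhd.
  rewrite in_setU negb_or (edge_repsP elv) (negPf V1v) andbF andbT.
  by apply: contraL V1l => /V2_V1.
move=> rv; have : v \in V1 e by move: rv; rewrite !inE => /andP[/andP[]].
rewrite inE => /cards1P[l vl]; have evl : e v l.
  by have := set11 l; rewrite -vl inE.
have elv : e l v by rewrite symE.
move: rv; rewrite (edge_repsP evl) => /and3P[V1v V1l lt].
exists l; last exact: V1_nbhd.
rewrite in_setU negb_or (edge_repsP elv) V1v V1l /= -leqNgt (ltnW lt) andbT.
by apply: contraL V1l => /V2_V1.
Qed.

Lemma leaf_edge v : v \in centers -> e (leaf v) v.
Proof. by move=> /leafP[_ nl]; have := set11 v; rewrite -nl inE. Qed.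

Lemma leaf_inj : {in centers &, injective leaf}.
Proof.
move=> u v Cu Cv luv; have [_ nu] := leafP Cu; have [_ nv] := leafP Cv.
by apply: set1_inj; rewrite -nu -nv luv.
Qed.

(** Every edge contains a center, and disjoint edges contain different ones; conversely, the edges
    joining each center to its leaf are pairwise disjoint. *)
Lemma matching_numberE : matching_number e = #|centers|.
Proof.
apply/eqP; rewrite eqn_leq; apply/andP; split.
  apply/bigmax_leqP => M /andP[/forall_inP edgeM /forall_inP disjM].
  have centerM f : f \in M -> exists2 v, v \in f & v \in centers.
    move=> /edgeM/existsP[x /existsP[y /andP[exy /eqP->]]].
    have [Cx|/notin_centers_nbr/(_ exy) Cy] := boolP (x \in centers).
      by exists x; rewrite ?set21.
    by exists y; rewrite ?set22.
  pose c (f : {set 'I_n}) := [pick v | (v \in f) && (v \in centers)].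
  have cP f : f \in M -> exists v, [/\ c f = Some v, v \in f & v \in centers].
    move=> /centerM[v fv Cv]; rewrite /c; case: pickP => [u /andP[fu Cu]|/(_ v)].
      by exists u.
    by rewrite fv Cv.
  have injc : {in M &, injective c}.
    move=> f g fM gM; have [u [-> fu _]] := cP f fM; have [v [-> gv _]] := cP g gM.
    case=> uv; apply/eqP/negPn/negP => nfg.
    have /forall_inP/(_ g gM)/implyP/(_ nfg) := disjM f fM.
    by move/disjoint_setI0/setP/(_ u); rewrite !inE fu uv gv.
  rewrite -(card_in_imset injc) -(card_imset (mem centers) Some_inj).
  apply: subset_leq_card; apply/subsetP => _ /imsetP[f fM ->].
  by have [v [-> _ Cv]] := cP f fM; apply: imset_f.
pose E v := [set v; leaf v].
have EC u v x : u \in centers -> v \in centers -> x \in E u -> x \in E v -> u = v.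
  move=> Cu Cv; have [lu _] := leafP Cu; have [lv _] := leafP Cv.
  rewrite !inE => /orP[/eqP->|/eqP->] /orP[/eqP|/eqP] //.
  - by move=> uE; rewrite uE (negPf lv) in Cu.
  - by move=> vE; rewrite vE Cv in lu.
  - exact: leaf_inj.
have injE : {in centers &, injective E}.
  move=> u v Cu Cv Euv; apply: (EC u v u) => //; rewrite -?Euv; exact: set21.
rewrite -(card_in_imset injE).
apply: (leq_bigmax_cond (F := fun M : {set {set 'I_n}} => #|M|)).
apply/andP; split; apply/forall_inP => _ /imsetP[v Cv ->].
  apply/existsP; exists v; apply/existsP; exists (leaf v).
  by rewrite symE leaf_edge /=.
apply/forall_inP => _ /imsetP[u Cu ->]; apply/implyP => nE.
rewrite -setI_eq0; apply/eqP/setP => x; rewrite in_set0; apply: contraNF nE.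
by rewrite inE => /andP[xv xu]; rewrite (EC v u x).
Qed.

(** [mate] is an involution of [V1'] exchanging [edge_reps] with its complement there, so
    [edge_reps] is half of [V1']. *)
Lemma card_centers : (2 * #|centers| = 2 * #|V2 e| + #|V1' e|)%N.
Proof.
have disj : [disjoint V2 e & edge_reps].
  rewrite -setI_eq0; apply/eqP/setP => x; rewrite in_set0 in_setI.
  apply/andP => -[/V2_V1 nV1x]; rewrite 2!in_set -andbA => /andP[V1x _].
  by rewrite V1x in nV1x.
pose mate x := odflt x [pick y | e x y].
have mateP x : x \in V1 e -> e x (mate x).
  rewrite inE => /cards1P[y xy]; have exy : e x y.
    by have := set11 y; rewrite -xy inE.
  by rewrite /mate; case: pickP => [//|/(_ y)]; rewrite exy.
have V1'V1 x : x \in V1' e -> x \in V1 e by rewrite [x \in V1' e]in_set => /andP[].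
have mateV1' x : x \in V1' e -> mate x \in V1' e.
  move=> V1'x; have exm := mateP x (V1'V1 x V1'x).
  have emx : e (mate x) x by rewrite symE.
  by rewrite (V1'P emx) andbC -(V1'P exm).
have mateK x : x \in V1' e -> mate (mate x) = x.
  move=> V1'x; have V1m := V1'V1 _ (mateV1' x V1'x).
  apply: V1_nbr_eq V1m (mateP _ V1m) _; rewrite symE; exact/mateP/V1'V1.
have repsE x : x \in V1' e -> (x \in edge_reps) = (x < mate x)%N.
  move=> V1'x; have exm := mateP x (V1'V1 x V1'x).
  by move: V1'x; rewrite (edge_repsP exm) (V1'P exm) andbA => ->.
have sub : edge_reps \subset V1' e by apply/subsetP => x; rewrite inE => /andP[].
have mateN x : x \in V1' e -> (mate x \in edge_reps) = (x \notin edge_reps).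
  move=> V1'x; rewrite !repsE ?mateV1' // mateK // -leqNgt [RHS]leq_eqVlt.
  case: eqP => // xm; have := mateP x (V1'V1 x V1'x).
  by rewrite (val_inj xm); case: simple_e => _ ->.
have -> : (#|V1' e| = #|edge_reps| + #|edge_reps|)%N.
  rewrite -(cardsID edge_reps) (setIidPr sub); congr (_ + _)%N.
  rewrite -(@card_in_imset _ _ mate edge_reps) => [|x y rx ry mxy]; last first.
    by rewrite -(mateK x) ?(subsetP sub) // mxy mateK ?(subsetP sub).
  congr #|pred_of_set _|; apply/setP => x; rewrite in_setD; apply/andP/imsetP.
    by move=> [nx V1'x]; exists (mate x); rewrite ?mateN ?mateK.
  move=> [y ry ->]; have V1'y := subsetP sub y ry.
  by rewrite mateN // ry mateV1'.
by rewrite cardsU (disjoint_setI0 disj) cards0; lia.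
Qed.

Lemma closed_nbhd_centers w : w \notin centers -> closed_nbhd e w \subset w |: centers.
Proof.
move=> Cw; apply: setUS; apply/subsetP => y; rewrite inE; exact: notin_centers_nbr.
Qed.

Lemma closed_nbhd_private w u : w \notin centers -> u \notin centers ->
  (w \in closed_nbhd e u) = (w == u).
Proof.
move=> Cw Cu; rewrite !inE; case: eqP => //= _; apply: contraNF Cw.
exact: notin_centers_nbr.
Qed.

End Graph.

(** * Generators and resolution of the closed neighbourhood ideal *)

Section ClosedNbhdIdeal.
Variables (k : fieldType) (n : nat) (e : rel 'I_n).
Hypotheses (simple_e : simple_graph e) (indepV3 : independent e (V3 e)).
Local Notation R := {mpoly k[n]}.
Local Notation C := (centers e).

(** The closed neighbourhood of the leaf of a center [v] consists of the leaf and [v], so it lies in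
    that of [v]: the generator at [v] is a multiple of the one at its leaf. *)
Lemma NI_centers (p : R) : NI e p <->
  exists c : 'I_n -> R, p = \sum_(w in ~: C) c w * Xset k (closed_nbhd e w).
Proof.
have genE i : NI_gen k e i = Xset k (closed_nbhd e i) by rewrite Xset_prod.
split=> [[c ->]|[c ->]]; last first.
  exists (fun i => if i \in ~: C then c i else 0); rewrite big_mkcond.
  by apply: eq_bigr => i _; rewrite genE; case: ifP; rewrite ?mul0r.
pose q v := Xset k (closed_nbhd e v :\: closed_nbhd e (leaf e v)).
have genC v : v \in C -> NI_gen k e v = q v * Xset k (closed_nbhd e (leaf e v)).
  move=> Cv; rewrite genE mulrC XsetD //; have [_ nl] := leafP simple_e Cv.
  rewrite /closed_nbhd nl subUset !sub1set !inE eqxx /= andbT.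
  by case: (simple_e) => sym _; rewrite sym leaf_edge ?orbT.
(* The coefficient at [w] absorbs those of the centers whose leaf is [w]. *)
exists (fun w => c w + \sum_(v in C | leaf e v == w) c v * q v).
rewrite (bigID (mem (~: C))) /=.
under [RHS]eq_bigr => w _ do rewrite mulrDl.
rewrite big_split /=; congr (_ + _); first by apply: eq_bigr => w _; rewrite genE.
rewrite (eq_bigl (mem C)) => [|v]; last by rewrite inE negbK.
rewrite (partition_big (leaf e) (mem (~: C))) /= => [|v Cv]; last first.
  by rewrite inE; have [] := leafP simple_e Cv.
apply: eq_bigr => w _; rewrite mulr_suml; apply: eq_bigr => v /andP[Cv /eqP<-].
by rewrite genC // mulrA.
Qed.

Lemma NI_sub_prime (Q : R -> Prop) : is_prime Q ->
  subI (NI e) Q <-> forall w, w \in ~: C -> Q 'X_[mesym1 (closed_nbhd e w)].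
Proof.
move=> [idQ _]; split=> [subQ w Cw|genQ p /NI_centers[c ->]].
  apply/subQ/NI_centers; exists (fun i => (i == w)%:R).
  rewrite (bigD1 w) //= eqxx mul1r big1 ?addr0 // => i /andP[_ /negPf->].
  by rewrite mul0r.
apply: ideal_sum => // w Cw; case: idQ => _ [_]; apply; exact: genQ.
Qed.

Local Notation F := (taylor k (~: C) (closed_nbhd e)).

Lemma taylor_NI_resolution : graded_free_resolution (@NI k n e) F.
Proof. exact: taylor_resolution NI_centers. Qed.

Lemma taylor_NI_minimal : minimal_res F.
Proof.
apply: taylor_minimal => w; rewrite inE => Cw; exists w; first exact: setU11.
by move=> u; rewrite inE => Cu; rewrite closed_nbhd_private // => /eqP.
Qed.

Lemma taylor_NI_reg : res_reg F = #|C|.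
Proof.
apply/eqP; rewrite eqn_leq; apply/andP; split.
  apply/bigmax_leqP => i _; apply/bigmax_leqP => l _ /=; rewrite leq_subLR.
  have := enum_valP l; rewrite inE => /andP[/subsetP SC /eqP cS].
  rewrite -{2}cS; apply: leq_trans (leq_card_setU _ _); apply: subset_leq_card.
  apply/bigcupsP => w Sw; apply: subset_trans (_ : w |: C \subset _).
    by apply: closed_nbhd_centers => //; have := SC w Sw; rewrite inE.
  by apply: setSU; rewrite sub1set.
have fW : ~: C \in faces (~: C) #|~: C| by rewrite inE subxx eqxx.
rewrite /res_reg; apply: leq_trans (leq_bigmax_cond ord_max _) => //=.
apply: leq_trans (leq_bigmax_cond (enum_rank_in fW (~: C)) _) => //=.
(* A vertex outside [C] lies in its own closed neighbourhood, and a center in that of its leaf. *)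
rewrite enum_rankK_in //; suff -> : lcm_set (closed_nbhd e) (~: C) = setT.
  by rewrite cardsT -(cardsC C) addnK.
apply/setP => x; rewrite [RHS]inE; apply/bigcupP.
have [Cx|Cx] := boolP (x \in C); last first.
  by exists x; rewrite ?in_setC ?setU11.
have [lC _] := leafP simple_e Cx; exists (leaf e x); first by rewrite in_setC.
by rewrite !inE leaf_edge ?orbT.
Qed.

End ClosedNbhdIdeal.

Theorem theorem2p7 (k : fieldType) (n : nat) (e : rel 'I_n) :
  simple_graph e ->
  independent e (V3 e) ->
  [/\ (* (i) a_G = |V2| + |V1'|/2 *)
      (2 * matching_number e = 2 * #|V2 e| + #|V1' e|)%N,
      (* a minimal graded free resolution of R/NI(G) exists *)
      (exists F : graded_free_complex k n,
          graded_free_resolution (@NI k n e) F /\ minimal_res F),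
      (* (ii) reg(R/NI(G)) = a_G  and (iii) pd(R/NI(G)) = n - a_G *)
      (forall F : graded_free_complex k n,
          graded_free_resolution (@NI k n e) F -> minimal_res F ->
          res_reg F = matching_number e /\
          res_pd F = (n - matching_number e)%N) &
      (* (iii) bight(NI(G)) = n - a_G *)
      bight_eq (@NI k n e) (n - matching_number e)%N].
Proof.
move=> simple_e indepV3; rewrite matching_numberE //.
have resT := taylor_NI_resolution k simple_e.
have minT := @taylor_NI_minimal k n e simple_e indepV3.
have cardW : #|~: centers e| = (n - #|centers e|)%N by rewrite cardsCs setCK card_ord.
rewrite -cardW; split; first exact: card_centers.
- by exists (taylor k (~: centers e) (closed_nbhd e)).
(* Two minimal resolutions bound each other in both invariants, so [F] has those of the Taylor
   resolution. *)
- move=> F resF minF; rewrite -(taylor_NI_reg k) //; split; apply/eqP; rewrite eqn_leq.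
    by rewrite (res_reg_le resF resT minF) (res_reg_le resT resF minT).
  by rewrite (res_len_le resF resT minF) (res_len_le resT resF minT).
apply: bight_private (fun Q => @NI_sub_prime k n e simple_e Q) _ => w w'.
by rewrite !in_setC => Cw Cw'; apply: closed_nbhd_private.
Qed.
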